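(* Let $PO(n)$, $QO(n)$ and $Tr(n)$ denote, respectively, the number of partial orders, of quasi-orders (preorders), and of transitive relations on the set $[n]=\{1,\ldots,n\}$. Then the sequences $PO(n)$, $QO(n)$ and $Tr(n)$ are MC-finite.
   Context: All three functions count binary relations $E\subseteq[n]^2$ on the labeled set $[n]$ with the stated property. MC-finite: an integer sequence $s(n)$ is MC-finite if for every positive integer $m$ it satisfies a linear recurrence with constant coefficients modulo $m$: there are $r(m),p(m)\in\mathbb{N}^+$ and integers $\alpha_0,\ldots,\alpha_{p(m)}$ (depending on $m$) such that $s(n+p(m)+1)\equiv\sum_{i=0}^{p(m)}\alpha_i\, s(n+i)\pmod m$ for all $n\ge r(m)$. Equivalently, for every $m$ the sequence $s(n)\bmod m$ is ultimately periodic. *)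

(* Defs.v *)
From mathcomp Require Import all_boot all_algebra.

Set Implicit Arguments.
Unset Strict Implicit.
Unset Printing Implicit Defensive.

(* A binary relation E on [n] is a subset of [n]^2; the label set {1, ..., n}
   is encoded as 'I_n = {0, ..., n-1}. *)
Definition brel (n : nat) : finType := {set 'I_n * 'I_n}.

Definition rel_of (n : nat) (E : brel n) : rel 'I_n :=
  fun x y => (x, y) \in (E : {set 'I_n * 'I_n}).

Section BooleanProperties.
Variables (T : finType) (R : rel T).

Definition reflexiveb : bool := [forall x, R x x].

Definition antisymmetricb : bool :=
  [forall x, forall y, R x y && R y x ==> (x == y)].

Definition transitiveb : bool :=
  [forall x, forall y, forall z, R x y && R y z ==> R x z].

Lemma reflexivebP : reflect (reflexive R) reflexiveb.
Proof. exact: forallP. Qed.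

Lemma antisymmetricbP : reflect (antisymmetric R) antisymmetricb.
Proof.
apply: (iffP forallP) => H x.
  by move=> y Rxy; apply/eqP; move/forallP/(_ y)/implyP: (H x); apply.
by apply/forallP=> y; apply/implyP=> Rxy; apply/eqP; apply: H.
Qed.

Lemma transitivebP : reflect (transitive R) transitiveb.
Proof.
apply: (iffP forallP) => [H y x z Rxy Ryz | H x].
  move/forallP/(_ y)/forallP/(_ z)/implyP: (H x); apply.
  by rewrite Rxy.
apply/forallP=> y; apply/forallP=> z; apply/implyP=> /andP[Rxy Ryz].
exact: H Rxy Ryz.
Qed.

Definition partial_orderb : bool :=
  [&& reflexiveb, antisymmetricb & transitiveb].

Definition quasi_orderb : bool := reflexiveb && transitiveb.

End BooleanProperties.

Definition PO (n : nat) : nat := #|[set E : brel n | partial_orderb (rel_of E)]|.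
Definition QO (n : nat) : nat := #|[set E : brel n | quasi_orderb (rel_of E)]|.
Definition Tr (n : nat) : nat := #|[set E : brel n | transitiveb (rel_of E)]|.

Definition MC_finite (s : nat -> int) : Prop :=
  forall m : nat, (0 < m)%N ->
  exists (r p : nat) (alpha : 'I_p.+1 -> int),
    [/\ (0 < r)%N, (0 < p)%N &
      forall n : nat, (r <= n)%N ->
        (s (n + p + 1)%N = (\sum_(i < p.+1) alpha i * s (n + i)%N)%R
           %[mod m%:Z])%Z].

(* Main.v *)
Require Import Defs.
From mathcomp Require Import all_boot all_algebra all_fingroup.
From mathcomp Require Import zify.

(* Two vertices are clones when they have the same in- and out-neighbours. Let
   S(n, K) count the strict orders on n + K points in which no two of the K
   distinguished points are clones. Deciding whether a new point is a clone of a
   distinguished one gives S(n+1, K) = S(n, K+1) + K S(n, K). For K >= 2 m^2 the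
   number S(n, K) is divisible by m: for a prime power p^e dividing m exactly, let
   F_p^N with N = 2e rotate N disjoint blocks of p distinguished points. If W is
   the stabilizer of a strict order and block i can be rotated by W while any
   prescribed other block stays still, then block i consists of clones. Otherwise
   each coordinate w_i on W is forced to vanish by another one, so at most N/2
   coordinates determine w, and all orbits have at least p^(N/2) elements. Hence
   S(n, .) modulo m evolves in a finite state space, and PO(n) = S(n, 0) is
   ultimately periodic.

   For transitive relations let V(n, a, b) count those on n + a + b points in which
   a given points have no loop and b given points have loops and are pairwise
   inequivalent. Then V(n+1, a, b) = b V(n, a, b) + V(n, a+1, b) + V(n, a, b+1)
   (for quasi-orders, without the middle term) and V(0, a, b) = PO(a+b), so V(n, ., .)
   modulo m is periodic in a and b and again evolves in a finite state space. *)

Set Implicit Arguments.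
Unset Strict Implicit.
Unset Printing Implicit Defensive.

Import GRing.Theory.

(** * Finite state systems *)

Lemma pigeonhole_seq (S : finType) (x : nat -> S) : exists i j, i < j /\ x i = x j.
Proof.
pose f (i : 'I_#|S|.+1) := x i.
have /injectivePn[i [j neq_ij fij]]: ~~ injectiveb f.
  by apply/injectiveP => /leq_card; rewrite card_ord ltnn.
by case: (ltngtP i j) neq_ij => [ij _|ji _|/val_inj ->];
  [exists i, j|exists j, i|rewrite eqxx].
Qed.

(** The state at time [n] is the family of residues of [W n i]; the list [l] of representatives
    makes it a finite tuple, so two states coincide, and the deterministic step repeats everything
    from there on. *)
Lemma finite_state_periodic (I : eqType) (W : nat -> I -> nat) (m : nat) (l : seq I) :
    0 < m ->
    (forall i, exists2 j, j \in l & forall n, W n i = W n j %[mod m]) ->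
    (forall n n', (forall i, W n i = W n' i %[mod m]) ->
       forall i, W n.+1 i = W n'.+1 i %[mod m]) ->
  exists r q, 0 < q /\ forall n i, r <= n -> W (n + q) i = W n i %[mod m].
Proof.
case: m => // m _ red step.
pose x n : (size l).-tuple 'I_m.+1 := map_tuple (fun j => inord (W n j %% m.+1)) (in_tuple l).
have [r [r' [lt_rr' xE]]] := pigeonhole_seq x.
have base i : W r i = W r' i %[mod m.+1].
  have [j jl Wij] := red i; rewrite !Wij.
  have := congr1 (fun t : (size l).-tuple 'I_m.+1 => nat_of_ord (nth ord0 t (index j l))) xE.
  rewrite /x !(nth_map j) ?index_mem // !nth_index //= !inordK ?ltn_mod //; exact.
exists r, (r' - r); split; first by rewrite subn_gt0.
move=> n i le_rn; have -> : n = r + (n - r) by lia.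
elim: (n - r) i => [|k IHk] i.
  by rewrite addn0 subnKC 1?ltnW.
by rewrite addnS addSn; apply: step.
Qed.

Lemma periodic_MC_finite (s : nat -> nat) :
    (forall m, 0 < m -> exists r q, 0 < q /\
       forall n, r <= n -> s (n + q) = s n %[mod m]) ->
  MC_finite (fun n => Posz (s n)).
Proof.
move=> per m m_gt0; have [r [q [q_gt0 sP]]] := per m m_gt0.
(* The recurrence is s(n + 2q) = s(n): its order is [p + 1], so [p] is 2q - 1, which stays positive
   even for [q] equal to 1. *)
exists r.+1, (q + q - 1), (fun i => Posz (i == ord0)); split=> //; first by lia.
move=> n rn; rewrite big_ord_recl big1 => [|i _]; last by rewrite mul0r.
rewrite mul1r addr0 addn0 !modz_nat.
have -> : n + (q + q - 1) + 1 = n + q + q by lia.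
by rewrite !sP ?(leq_trans (ltnW rn)) ?leq_addr.
Qed.

(** * Counting relations up to bijection *)

(** Each point goes to the point of the same rank in the fibre of its colour; this is injective, and
    the injection the other way makes it bijective by cardinality. *)
Lemma colored_bij (C : eqType) (U U' : finType) (k : U -> C) (k' : U' -> C) :
    (forall c, #|[pred x | k x == c]| = #|[pred x | k' x == c]|) ->
  exists2 f : U -> U', bijective f & forall x, k' (f x) = k x.
Proof.
have inj (V V' : finType) (h : V -> C) (h' : V' -> C) :
    (forall c, #|[pred x | h x == c]| = #|[pred x | h' x == c]|) ->
    exists2 f : V -> V', injective f & forall x, h' (f x) = h x.
  move=> hE.
  have fib x : enum_rank_in (eqxx (h x) : x \in [pred y | h y == h x]) x
      < #|[pred y | h' y == h x]| by rewrite -hE.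
  pose f x := enum_val (Ordinal (fib x)).
  have fE x : h' (f x) = h x by apply/eqP; have := enum_valP (Ordinal (fib x)).
  exists f => // x y fxy.
  have hxy : h x = h y by rewrite -!fE fxy.
  have: enum_rank_in (eqxx (h x) : x \in [pred y | h y == h x]) x
      = enum_rank_in (eqxx (h y) : y \in [pred z | h z == h y]) y :> nat.
    move: fxy; rewrite /f.
    move: (fib x) (fib y); set a := nat_of_ord _; set b := nat_of_ord _.
    move: a b; rewrite hxy => a b ax bx /enum_val_inj /(congr1 val); exact.
  set a := nat_of_ord _; set b := nat_of_ord _ => ab.
  have nthE z : z = nth x (enum [pred y | h y == h z])
      (enum_rank_in (eqxx (h z) : z \in [pred y | h y == h z]) z).
    by rewrite -(enum_val_nth x) enum_rankK_in ?inE.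
  by rewrite (nthE x) (nthE y) -/a -/b ab hxy.
move=> kE; have [f f_inj fE] := inj _ _ k k' kE.
have [g g_inj _] := inj _ _ k' k (fun c => esym (kE c)).
by exists f => //; apply: inj_card_bij (leq_card g g_inj).
Qed.

(** Double counting: by uniqueness each [E] contributes to at most one summand. *)
Lemma card_exists_uniq (S D : finType) (P : pred S) (d : pred D) (R : D -> S -> bool) :
    (forall E a b, P E -> d a -> d b -> R a E -> R b E -> a = b) ->
  #|[set E | P E && [exists a, d a && R a E]]| = \sum_(a | d a) #|[set E | P E && R a E]|.
Proof.
move=> uniqR; rewrite -sum1dep_card big_mkcond /=.
under [RHS]eq_bigr do rewrite -sum1dep_card big_mkcond /=.
rewrite exchange_big /=; apply: eq_bigr => E _.
case PE: (P E) => /=; last by rewrite big1.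
case: existsP => [[a /andP[da Ra]] | nex].
  rewrite (bigD1 a) //= Ra big1 // => b /andP[db ba].
  by case Rb: (R b E) => //; case/eqP: ba; apply: (uniqR E).
rewrite big1 // => a da; case Ra: (R a E) => //.
by case: nex; exists a; rewrite da.
Qed.

(** Used along bijections to relabel, along [Some] to delete the extra point, and along [odflt a] to
    make the extra point a copy of [a]. *)
Definition pull (T U : finType) (f : T -> U) (E : {set U * U}) : {set T * T} :=
  [set xy | (f xy.1, f xy.2) \in E].

Lemma in_pull (T U : finType) (f : T -> U) E x y :
  ((x, y) \in pull f E) = ((f x, f y) \in E).
Proof. by rewrite inE. Qed.

Definition edge (T : finType) (E : {set T * T}) : rel T := fun x y => (x, y) \in E.

Lemma pull_trans (T U : finType) (f : T -> U) E :
  transitiveb (edge E) -> transitiveb (edge (pull f E)).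
Proof.
move=> /transitivebP trE; apply/transitivebP => y x z.
by rewrite /edge !in_pull; apply: trE.
Qed.

Lemma pull_inj (T U : finType) (f : T -> U) : bijective f -> injective (pull f).
Proof.
case=> g fK gK E E' eqE; apply/setP => -[x y].
by rewrite -(gK x) -(gK y) -!in_pull eqE.
Qed.

(** As [z] may be [x] or [y], clones in a strict order are incomparable. *)
Definition clone (T : finType) (E : {set T * T}) (x y : T) : bool :=
  [forall z, (((z, x) \in E) == ((z, y) \in E)) && (((x, z) \in E) == ((y, z) \in E))].

Lemma cloneP (T : finType) (E : {set T * T}) x y :
  reflect (forall z, ((z, x) \in E) = ((z, y) \in E) /\ ((x, z) \in E) = ((y, z) \in E))
          (clone E x y).
Proof.
apply: (iffP forallP) => H z; first by have /andP[/eqP-> /eqP->] := H z.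
by have [-> ->] := H z; rewrite !eqxx.
Qed.

Definition ext (U : Type) (C : Type) (k : U -> C) (c : C) (o : option U) : C :=
  if o is Some x then k x else c.

(** A clone of [a] has no freedom: such an [E] is recovered from its restriction to [U] by
    duplicating [a]. *)
Lemma card_cloned (U : finType) (a : U) (Q : pred {set option U * option U})
    (Q' : pred {set U * U}) :
    (forall E, Q' E -> Q (pull (odflt a) E)) ->
    (forall E, Q E -> Q' (pull Some E)) ->
    (forall E, Q E -> clone E None (Some a)) ->
  #|[set E | Q E]| = #|[set E | Q' E]|.
Proof.
move=> QQ' Q'Q Qcl.
rewrite -(card_in_imset (f := pull (odflt a)) (D := [set E | Q' E])); last first.
  move=> E E' _ _ eqE; apply/setP => -[x y].
  by have /setP/(_ (Some x, Some y)) := eqE; rewrite !in_pull.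
apply: eq_card => E; rewrite inE; apply/idP/imsetP => [QE | [E']]; last first.
  by rewrite inE => /QQ' ? ->.
exists (pull Some E); first by rewrite inE Q'Q.
have /cloneP cl := Qcl E QE.
apply/setP => -[x y]; rewrite !in_pull.
have cr z : ((z, y) \in E) = ((z, Some (odflt a y)) \in E).
  by case: y => // ; have [] := cl z.
have cL z : ((x, z) \in E) = ((Some (odflt a x), z) \in E).
  by case: x => // ; have [] := cl z.
by rewrite cr cL.
Qed.

(** * Strict orders without distinguished clones *)

Definition strict_nc (U : finType) (k : pred U) (E : {set U * U}) : bool :=
  [&& transitiveb (edge E), [forall x, (x, x) \notin E] &
      [forall x, forall y, [&& k x, k y & clone E x y] ==> (x == y)]].

Lemma strict_ncP (U : finType) (k : pred U) (E : {set U * U}) :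
  reflect [/\ transitive (edge E), forall x, (x, x) \notin E &
              forall x y, k x -> k y -> clone E x y -> x = y] (strict_nc k E).
Proof.
apply: (iffP and3P) => -[/transitivebP trE irrE ncE]; split=> //.
- exact/forallP.
- by move=> x y kx ky cxy; apply/eqP; move/forallP/(_ x)/forallP/(_ y): ncE; rewrite kx ky cxy.
- exact/forallP.
- by apply/forallP => x; apply/forallP => y; apply/implyP => /and3P[kx ky cxy]; rewrite (ncE x y).
Qed.

Definition count_strict (U : finType) (k : pred U) : nat := #|[set E | strict_nc k E]|.

Lemma clone_sym (T : finType) (E : {set T * T}) x y : clone E x y = clone E y x.
Proof. by apply/cloneP/cloneP => H z; have [-> ->] := H z. Qed.

Lemma clone_trans (T : finType) (E : {set T * T}) y x z :
  clone E x y -> clone E y z -> clone E x z.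
Proof.
by move=> /cloneP H /cloneP H'; apply/cloneP => t; have [-> ->] := H t; have [-> ->] := H' t.
Qed.

Lemma count_strict_bij (U U' : finType) (k : pred U) (k' : pred U') :
    #|[pred x | k x]| = #|[pred x | k' x]| -> #|U| = #|U'| ->
  count_strict k = count_strict k'.
Proof.
have le (V V' : finType) (h : pred V) (h' : pred V') (f : V -> V') :
    bijective f -> (forall x, h' (f x) = h x) -> count_strict h' <= count_strict h.
  move=> bij_f fE; rewrite /count_strict -(card_imset _ (pull_inj bij_f)).
  apply/subset_leq_card/subsetP => _ /imsetP[E + ->].
  rewrite !inE => /strict_ncP[/transitivebP trE irrE ncE]; apply/strict_ncP; split.
  - exact/transitivebP/pull_trans.
  - by move=> x; rewrite in_pull.
  - move=> x y hx hy /cloneP cxy; apply: (bij_inj bij_f).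
    apply: ncE; rewrite ?fE //; apply/cloneP => z.
    by have [g fK gK] := bij_f; have := cxy (g z); rewrite !in_pull gK.
move=> cardk cardU; have kE c : #|[pred x | k x == c]| = #|[pred x | k' x == c]|.
  have eqT (V : finType) (h : pred V) : #|[pred x | h x == true]| = #|[pred x | h x]|.
    by apply: eq_card => x; rewrite !inE eqb_id.
  case: c; first by rewrite !eqT.
  have := cardC [pred x | k x]; rewrite cardk cardU -(cardC [pred x | k' x]) => /addnI e.
  transitivity #|[predC [pred x | k x]]|; first by apply: eq_card => x; rewrite !inE eqbF_neg.
  by rewrite e; apply: eq_card => x; rewrite !inE eqbF_neg.
have [f bij_f fE] := colored_bij kE; have [g bij_g gE] := colored_bij (fun c => esym (kE c)).
by apply/eqP; rewrite eqn_leq (le _ _ _ _ _ bij_f fE) (le _ _ _ _ _ bij_g gE).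
Qed.

(** Either the new point is a clone of no distinguished point and can itself be distinguished, or it
    copies exactly one of them, since distinguished points are not clones of each other. *)
Lemma count_strict_option (U : finType) (k : pred U) :
  count_strict (ext k false) = count_strict (ext k true) + #|[pred x | k x]| * count_strict k.
Proof.
rewrite /count_strict -[LHS](cardsID [set E | [exists a, k a && clone E None (Some a)]]) addnC.
congr (_ + _).
  apply: eq_card => E; rewrite !inE; apply/andP/strict_ncP.
    case=> nex /strict_ncP[trE irrE ncE]; split=> //.
    have nocl a : k a -> clone E None (Some a) -> False.
      by move=> ka ca; case/existsP: nex; exists a; rewrite ka.
    move=> [x|] [y|] //= kx ky; first exact: ncE.
      by rewrite clone_sym => /(nocl _ kx).
    by move=> /(nocl _ ky).
  case=> trE irrE ncE; split; last first.
    by apply/strict_ncP; split=> // -[x|] [y|] //= kx ky; apply: ncE.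
  by apply/existsP => -[a /andP[ka /(ncE None (Some a) isT ka)]].
rewrite -sum_nat_const.
have -> : #|[set E | strict_nc (ext k false) E] :&:
            [set E | [exists a, k a && clone E None (Some a)]]|
    = \sum_(a | k a) #|[set E | strict_nc (ext k false) E && clone E None (Some a)]|.
  rewrite -card_exists_uniq; first by apply: eq_card => E; rewrite !inE.
  move=> E a b /strict_ncP[_ _ ncE] ka kb; rewrite clone_sym => ca cb.
  by case: (ncE (Some a) (Some b) ka kb (clone_trans ca cb)).
apply: eq_bigr => a ka; apply: (card_cloned (a := a)) => E.
- move=> /strict_ncP[/transitivebP trE irrE ncE]; apply/andP; split.
    apply/strict_ncP; split; [exact/transitivebP/pull_trans | by move=> x; rewrite in_pull |].
    move=> [x|] [y|] //= kx ky /cloneP cxy; congr Some; apply: ncE => //.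
    by apply/cloneP => z; have := cxy (Some z); rewrite !in_pull.
  by apply/cloneP => z; rewrite !in_pull.
- case/andP => /strict_ncP[/transitivebP trE irrE ncE] /cloneP ca.
  apply/strict_ncP; split; [exact/transitivebP/pull_trans | by move=> x; rewrite in_pull |].
  move=> x y kx ky /cloneP cxy.
  have e : Some x = Some y; last by case: e.
  apply: ncE => //; apply/cloneP => -[z|].
    by have := cxy z; rewrite !in_pull.
  by have [-> ->] := ca (Some x); have [-> ->] := ca (Some y); have := cxy a; rewrite !in_pull.
- by case/andP.
Qed.

Definition is_inr (A B : Type) (x : A + B) : bool := if x is inr _ then true else false.

(** This is S(n, K), with the right summand as the distinguished points. *)
Definition Strict (n K : nat) : nat := count_strict (@is_inr 'I_n 'I_K).

Lemma card_is_inr n K : #|[pred x : 'I_n + 'I_K | is_inr x]| = K.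
Proof.
rewrite -[RHS](card_ord K) -(card_imset 'I_K (@inr_inj 'I_n 'I_K)).
by apply: eq_card => -[x|x]; rewrite !inE; apply/esym/imsetP; [case | exists x].
Qed.

Lemma count_strictE (U : finType) (k : pred U) n K :
  #|[pred x | k x]| = K -> #|U| = n + K -> count_strict k = Strict n K.
Proof.
by move=> kK Un; apply: count_strict_bij; rewrite ?card_is_inr ?card_sum ?card_ord.
Qed.

Lemma card_ext (U : finType) (C : eqType) (k : U -> C) c c' :
  #|[pred x | ext k c x == c']| = (c == c') + #|[pred x | k x == c']|.
Proof.
rewrite (cardD1 None) inE /=; congr (_ + _).
rewrite -(card_imset [pred x | k x == c'] (@Some_inj _)).
apply: eq_card => -[x|]; rewrite !inE /=; last by apply/esym/imsetP; case.
by apply/idP/imsetP => [kx | [y + [->]]]; [exists x|rewrite inE].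
Qed.

Lemma Strict_rec n K : Strict n.+1 K = Strict n K.+1 + K * Strict n K.
Proof.
have cE b : #|[pred x | ext (@is_inr 'I_n 'I_K) b x]| = b + K.
  rewrite -[in RHS](card_is_inr n K).
  transitivity #|[pred x | ext (@is_inr 'I_n 'I_K) b x == true]|.
    by apply: eq_card => x; rewrite !inE eqb_id.
  by rewrite card_ext eqb_id; congr (_ + _); apply: eq_card => x; rewrite !inE eqb_id.
rewrite -(@count_strictE (option ('I_n + 'I_K)%type) (ext (@is_inr _ _) false)).
- rewrite count_strict_option card_is_inr; congr (_ + _); apply: count_strictE; first by rewrite cE.
  by rewrite card_option card_sum !card_ord addnS.
- by rewrite cE.
- by rewrite card_option card_sum !card_ord addSn.
Qed.

(** * Divisibility by prime powers *)

(** A minimal set [D] of coordinates that determines the vectors of [W] is disjoint from its image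
    under [f], and [f] is injective on it; so 2|D| <= N, while restriction to [D] embeds [W] into
    F^D. *)
Lemma determined_card (F : finFieldType) N (W : {set 'rV[F]_N}) (f : 'I_N -> 'I_N) :
    (forall u v, u \in W -> v \in W -> (u - v)%R \in W) ->
    (forall i, f i != i /\ forall w, w \in W -> w ord0 (f i) = 0%R -> w ord0 i = 0%R) ->
  exists2 d, d.*2 <= N & #|W| <= #|F| ^ d.
Proof.
move=> subW fP.
pose det (D : {set 'I_N}) :=
  [forall w in W, [forall i in D, w ord0 i == 0%R] ==> (w == 0%R)].
have detP (D : {set 'I_N}) : reflect (forall w, w \in W ->
    (forall i, i \in D -> w ord0 i = 0%R) -> w = 0%R) (det D).
  apply: (iffP forall_inP) => H w wW.
    move=> w0; apply/eqP; apply: (implyP (H w wW)).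
    by apply/forall_inP => i /w0 ->.
  by apply/implyP => /forall_inP w0; apply/eqP/H => // i /w0/eqP.
have detT : det setT.
  by apply/detP => w _ w0; apply/rowP => i; rewrite mxE w0 ?inE.
have [D /detP detD minD] := arg_minnP (fun D : {set 'I_N} => #|D|) detT.
(* Otherwise [i] could be dropped from [D], as [f i] already forces coordinate [i] to vanish. *)
have fD i : i \in D -> f i \notin D.
  move=> iD; apply/negP => fiD; have [ne fi0] := fP i.
  have /= := minD (D :\ i); rewrite (cardsD1 i D) iD ltnn => minDi; suff: false by [].
  apply: minDi; apply/detP => w wW w0; apply: detD => // j jD.
  case: (eqVneq j i) => [-> | ji]; last by rewrite w0 // !inE ji.
  by apply: fi0 => //; rewrite w0 // !inE ne.
(* Otherwise [f i] could replace both [i] and [j] in [D]. *)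
have f_inj : {in D &, injective f}.
  move=> i j iD jD fij; apply/eqP/negPn/negP => ij.
  have /= := minD (f i |: (D :\ i :\ j)).
  rewrite cardsU1 !inE (negbTE (fD i iD)) !andbF /=.
  rewrite (cardsD1 i D) iD (cardsD1 j (D :\ i)) !inE eq_sym ij jD /= ltnn => minDij; suff: false by [].
  apply: minDij; apply/detP => w wW w0; apply: detD => // l lD.
  have fi0 : w ord0 (f i) = 0%R by rewrite w0 // !inE eqxx.
  case: (eqVneq l i) => [-> | li]; first exact: (fP i).2.
  case: (eqVneq l j) => [-> | lj]; first by apply: (fP j).2; rewrite // -fij.
  by rewrite w0 // !inE li lj lD orbT.
exists #|D|.
  rewrite -addnn -[X in _ <= X]card_ord -(cardsC D) leq_add2l -(card_in_imset f_inj).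
  by apply/subset_leq_card/subsetP => _ /imsetP[i iD ->]; rewrite inE fD.
pose r (w : 'rV[F]_N) := [ffun i => if i \in D then w ord0 i else 0%R].
rewrite -(card_pffun_on (0%R : F) (mem D) predT) -(card_in_imset (f := r)).
  apply/subset_leq_card/subsetP => _ /imsetP[w wW ->].
  apply/pffun_onP; split=> //; apply/subsetP => i; rewrite !inE ffunE.
  by case: ifP => //; rewrite eqxx.
move=> u v uW vW /ffunP uv; apply/eqP; rewrite -subr_eq0; apply/eqP.
apply: detD; first exact: subW.
by move=> i iD; have := uv i; rewrite !ffunE iD !mxE => ->; rewrite subrr.
Qed.

Section Blocks.
Variables (X : finType) (p N : nat) (p_pr : prime p).

Let U : finType := (X + 'I_N * 'F_p)%type.
Let G := 'rV['F_p]_N.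

(** Each of the [N] blocks is a copy of F_p, and block [i] is rotated by the [i]-th coordinate of
    [v]. *)
Definition shift (v : G) (x : U) : U :=
  if x is inr (i, c) then inr (i, (c + v ord0 i)%R) else x.

Lemma shiftD v w x : shift (v + w)%R x = shift v (shift w x).
Proof. by case: x => [//|[i c]] /=; rewrite mxE [(v _ _ + _)%R]addrC addrA. Qed.

Lemma shift0 x : shift 0%R x = x.
Proof. by case: x => [//|[i c]] /=; rewrite mxE addr0. Qed.

Lemma shift_act1 : (fun E (v : G) => pull (shift v) E)^~ 1%g =1 id.
Proof. by move=> E; apply/setP => -[x y]; rewrite in_pull !shift0. Qed.

Lemma shift_actM : forall E, act_morph (fun E (v : G) => pull (shift v) E) E.
Proof.
move=> E v w; apply/setP => -[x y].
by rewrite FinRing.zmodMgE !in_pull !shiftD.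
Qed.

Definition shift_action := TotalAction shift_act1 shift_actM.

Definition stab (E : {set U * U}) : {set G} := [set w | pull (shift w) E == E].

Lemma stabP (E : {set U * U}) (w : G) : reflect (forall x y, ((shift w x, shift w y) \in E) = ((x, y) \in E))
                          (w \in stab E).
Proof.
rewrite inE; apply: (iffP eqP) => wE; first by move=> x y; rewrite -in_pull wE.
by apply/setP => -[x y]; rewrite in_pull wE.
Qed.

Lemma stab_sub (E : {set U * U}) (u v : G) : u \in stab E -> v \in stab E -> (u - v)%R \in stab E.
Proof.
move=> /stabP uE /stabP vE; apply/stabP => x y.
by rewrite -vE -!shiftD addrC subrK uE.
Qed.

(** Together with [stab_sub] this makes the stabilizer a subspace over F_p, whose scalars are
    residues of natural numbers. *)
Lemma stab_muln (E : {set U * U}) (w : G) n : w \in stab E -> (w *+ n)%R \in stab E.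
Proof.
move=> /stabP wE; elim: n => [|n /stabP IHn]; apply/stabP => x y.
  by rewrite mulr0n !shift0.
by rewrite mulrS !shiftD wE IHn.
Qed.

(** If no other coordinate forces w_i = 0, block [i] can rotate by one step while any other
    prescribed block stays fixed; then its points are incomparable, and 0 and 1 in it are related
    alike to every outside point, hence clones. *)
Lemma nc_stab (k : pred U) (E : {set U * U}) : 1 < N -> (forall y, k (inr y)) -> strict_nc k E ->
  forall i, exists j, j != i /\ forall w, w \in stab E -> w ord0 j = 0%R -> w ord0 i = 0%R.
Proof.
move=> N_gt1 kr /strict_ncP[trE irrE ncE] i.
pose P j := (j != i) && [forall w in stab E, (w ord0 j == 0%R) ==> (w ord0 i == 0%R)].
have [j /andP[ji /forall_inP jP] | noP] := pickP P.
  exists j; split=> // w wE wj; apply/eqP.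
  by move/implyP: (jP w wE); apply; apply/eqP.
have unit_shift j : j != i -> exists2 w, w \in stab E & w ord0 j = 0%R /\ w ord0 i = 1%R.
  move=> ji; move/negbT: (noP j); rewrite /P ji => /forall_inPn[w wE].
  rewrite negb_imply => /andP[/eqP wj wi].
  (* Scaling by the inverse of w_i normalizes the rotation of block [i] to 1. *)
  exists (w *+ (w ord0 i)^-1%R)%R; first exact: stab_muln.
  by rewrite !mulmxnE wj mul0rn -mulr_natr natr_Zp mulfV.
have [i' i'i] : exists j, j != i.
  exists (if i == Ordinal (ltnW N_gt1) then Ordinal N_gt1 else Ordinal (ltnW N_gt1)).
  by case: (eqVneq i (Ordinal (ltnW N_gt1))) => [-> | ne]; rewrite ?(eq_sym _ i).
(* A relation from c to c' would propagate by rotation along c, c + d, c + 2d, ... and return to c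
   after [p] steps, against irreflexivity. *)
have block c c' : (inr (i, c), inr (i, c')) \notin E.
  apply/negP => cE; have [w /stabP wE [_ wi]] := unit_shift i' i'i.
  pose d : 'F_p := (c' - c)%R.
  have all_c n : (inr (i, c), inr (i, c + d *+ n.+1)%R) \in E.
    elim: n => [|n IHn]; first by rewrite mulr1n addrC subrK.
    apply: (trE _ _ _ IHn).
    have shE m x : shift (w *+ m)%R (inr (i, x)) = inr (i, (x + m%:R)%R).
      by rewrite /= mulmxnE wi.
    have /stabP mE : (w *+ (d *+ n.+1)%R)%R \in stab E by apply: stab_muln; apply/stabP.
    move: cE; rewrite -mE !shE natr_Zp.
    by rewrite [(d *+ n.+2)%R]mulrS addrA {2}/d [(c + (_ - _))%R]addrC subrK.
  have := all_c p.-1; rewrite prednK ?prime_gt0 // -mulr_natr.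
  by rewrite pchar_Fp_0 // mulr0 addr0 (negbTE (irrE _)).
have: inr (i, 0%R) = inr (i, 1%R) :> U; last by case => /eqP; rewrite eq_sym oner_eq0.
apply: ncE => //; apply/cloneP => z.
(* A stabilizing rotation that fixes [z] carries point 0 of block [i] to point 1. *)
have use w : w \in stab E -> w ord0 i = 1%R -> shift w z = z ->
    ((z, inr (i, 0%R)) \in E) = ((z, inr (i, 1%R)) \in E) /\
    ((inr (i, 0%R), z) \in E) = ((inr (i, 1%R), z) \in E).
  move=> /stabP wE wi wz; rewrite -[in LHS]wE -[X in _ /\ X = _]wE wz /= wi add0r.
  by [].
case: z use => [x|[j c]] use.
  by have [w wE [_ wi]] := unit_shift i' i'i; apply: use wE wi _.
case: (eqVneq j i) use => [-> _ | ji use]; first by rewrite !(negbTE (block _ _)).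
have [w wE [wj wi]] := unit_shift j ji.
by apply: use wE wi _; rewrite /= wj addr0.
Qed.

(** F_p^N acts on these strict orders; an orbit has p^N / |stab| elements, a power of p, and |stab|
    <= p^d with 2d <= N makes its exponent at least N/2 >= e. *)
Lemma dvdn_count_strict (k : pred U) e : 0 < e -> e.*2 <= N -> (forall y, k (inr y)) ->
  p ^ e %| count_strict k.
Proof.
move=> e_gt0 leN kr.
have act_nc : [acts [set: G], on [set E | strict_nc k E] | shift_action].
  apply/actsP => v _ E; rewrite !inE.
  have imp w E' : strict_nc k E' -> strict_nc k (pull (shift w) E').
    move=> /strict_ncP[/transitivebP trE irrE ncE]; apply/strict_ncP; split.
    - exact/transitivebP/pull_trans.
    - by move=> x; rewrite in_pull.
    - have kS x : k x -> k (shift w x) by case: x => [//|[i c] _]; apply: kr.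
      move=> x y kx ky /cloneP cxy.
      rewrite -(shift0 x) -(shift0 y) -(addNr w) !shiftD; congr (shift _ _).
      apply: ncE; rewrite ?kS //; apply/cloneP => z.
      have := cxy (shift (- w)%R z); rewrite !in_pull -!shiftD addrN shift0.
      by [].
  apply/idP/idP => [/(imp (- v)%R) | /imp]; last exact.
  have -> // : pull (shift (- v)%R) (shift_action E v) = E.
  by apply/setP => -[x y]; rewrite !in_pull -!shiftD addrN !shift0.
rewrite /count_strict -(acts_sum_card_orbit act_nc).
apply: dvdn_sum => _ /imsetP[E + ->]; rewrite inE => ncE.
have [f fP] : exists f : 'I_N -> 'I_N, forall i, f i != i /\
    forall w, w \in stab E -> w ord0 (f i) = 0%R -> w ord0 i = 0%R.
  have N_gt1 : 1 < N by apply: leq_trans leN; rewrite -addnn; case: (e) e_gt0 => // e'; rewrite addnS.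
  exact: (fin_all_exists (nc_stab N_gt1 kr ncE)).
have [d led cardW] := determined_card (@stab_sub E) fP.
have := card_orbit_stab shift_action [set: G]%G E.
rewrite cardsT card_mx card_Fp // mul1n.
have -> : #|'C_([set: G])[E | shift_action]%g| = #|stab E|.
  by rewrite setTI; apply: eq_card => w; rewrite !inE sub1set inE.
rewrite (card_Fp p_pr) in cardW.
move=> cardE; have /(dvdn_pfactor _ _ p_pr)[o _ oE] : #|orbit shift_action [set: G] E| %| p ^ N.
  by rewrite -cardE dvdn_mulr.
rewrite oE dvdn_exp2l //.
have : p ^ N <= p ^ (o + d) by rewrite -cardE oE expnD leq_mul2l cardW orbT.
by rewrite leq_exp2l ?prime_gt1 // -!addnn in leN led * ; lia.
Qed.
End Blocks.

(** It suffices to treat each p^e exactly dividing [m]; since p <= m and e < p^e <= m, the K >= 2m^2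
    distinguished points have room for 2e blocks of size p. *)
Lemma dvdn_Strict m n K : 0 < m -> 2 * m * m <= K -> m %| Strict n K.
Proof.
move=> m_gt0 leK; apply/dvdn_partP => // p; rewrite mem_primes => /and3P[p_pr _ pm].
rewrite p_part; set e := logn p m.
have e_gt0 : 0 < e by rewrite -pfactor_dvdn ?expn1.
have le_pm : p <= m by apply: dvdn_leq.
have le_em : e <= m.
  apply: leq_trans (ltnW (ltn_expl e (prime_gt1 p_pr))) _.
  by apply: dvdn_leq => //; rewrite pfactor_dvdnn.
have leB : e.*2 * p <= K by rewrite -addnn; nia.
(* Outside the blocks, the first [n] points are ordinary and the other K - 2ep are distinguished. *)
pose k (x : 'I_(n + (K - e.*2 * p)) + 'I_e.*2 * 'F_p) := if x is inl i then n <= i else true.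
rewrite -(@count_strictE _ k n K); first exact: dvdn_count_strict.
  have := cardC [pred x | k x]; rewrite card_sum card_prod card_Fp // !card_ord.
  have -> : #|predC [pred x | k x]| = n.
    pose g (i : 'I_n) : 'I_(n + (K - e.*2 * p)) + 'I_e.*2 * 'F_p := inl (lshift _ i).
    have g_inj : injective g by move=> i j [/val_inj].
    rewrite -[RHS]card_ord -(card_imset 'I_n g_inj).
    apply: eq_card => -[x|x]; rewrite !inE /=; last by apply/esym/imsetP; case.
    rewrite -ltnNge; apply/idP/imsetP => [xn | [y _ [->]]]; last exact: (ltn_ord y).
    by exists (Ordinal xn) => //; congr inl; apply: val_inj.
  by move=> cardk; apply/eqP; rewrite -(eqn_add2r n) cardk; apply/eqP; lia.
by rewrite card_sum card_prod card_Fp // !card_ord; lia.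
Qed.

(** * Transitive relations *)

(* Colours: [Some false] marks a vertex required to have no loop, [Some true] one
   of the chosen looped vertices, which must be pairwise inequivalent. When [c] is
   false every other vertex must have a loop. *)
Definition marked_trans (c : bool) (U : finType) (k : U -> option bool) (E : {set U * U}) : bool :=
  [&& transitiveb (edge E),
      [forall x, if k x is Some b then ((x, x) \in E) == b else c || ((x, x) \in E)] &
      [forall x, forall y, [&& k x == Some true, k y == Some true, (x, y) \in E & (y, x) \in E]
         ==> (x == y)]].

Lemma marked_transP (c : bool) (U : finType) (k : U -> option bool) (E : {set U * U}) :
  reflect [/\ transitive (edge E),
              forall x b, k x = Some b -> ((x, x) \in E) = b,
              forall x, k x = None -> c || ((x, x) \in E) &
              forall x y, k x = Some true -> k y = Some true ->
                (x, y) \in E -> (y, x) \in E -> x = y]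
          (marked_trans c k E).
Proof.
apply: (iffP and3P) => [[/transitivebP trE /forallP loopE /forallP neqE] | [trE loopE freeE neqE]].
  split=> // [x b kx | x kx | x y kx ky xy yx].
  - by have := loopE x; rewrite kx => /eqP.
  - by have := loopE x; rewrite kx.
  - by apply/eqP; move/forallP/(_ y): (neqE x); rewrite kx ky xy yx.
split; first exact/transitivebP.
  apply/forallP => x; case kx: (k x) => [b|]; last exact: freeE.
  by rewrite (loopE _ _ kx).
by apply/forallP => x; apply/forallP => y; apply/implyP => /and4P[/eqP kx /eqP ky xy yx];
  rewrite (neqE x y).
Qed.

Definition count_trans (c : bool) (U : finType) (k : U -> option bool) : nat :=
  #|[set E | marked_trans c k E]|.

Lemma count_trans_bij (c : bool) (U U' : finType) (k : U -> option bool) (k' : U' -> option bool) :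
    (forall o, #|[pred x | k x == o]| = #|[pred x | k' x == o]|) ->
  count_trans c k = count_trans c k'.
Proof.
have le (V V' : finType) (h : V -> option bool) (h' : V' -> option bool) (f : V -> V') :
    bijective f -> (forall x, h' (f x) = h x) -> count_trans c h' <= count_trans c h.
  move=> bij_f fE; rewrite /count_trans -(card_imset _ (pull_inj bij_f)).
  apply/subset_leq_card/subsetP => _ /imsetP[E + ->].
  rewrite !inE => /marked_transP[/transitivebP trE loopE freeE neqE]; apply/marked_transP; split.
  - exact/transitivebP/pull_trans.
  - by move=> x b; rewrite in_pull -fE; apply: loopE.
  - by move=> x; rewrite in_pull -fE; apply: freeE.
  - by move=> x y; rewrite !in_pull -!fE => hx hy xy yx; apply/(bij_inj bij_f)/neqE.
move=> kE; have [f bij_f fE] := colored_bij kE; have [g bij_g gE] := colored_bij (fun o => esym (kE o)).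
by apply/eqP; rewrite eqn_leq (le _ _ _ _ _ bij_f fE) (le _ _ _ _ _ bij_g gE).
Qed.

Lemma equiv_clone (T : finType) (E : {set T * T}) x y :
  transitive (edge E) -> (x, y) \in E -> (y, x) \in E -> clone E x y.
Proof.
move=> trE xy yx; apply/cloneP => z.
by split; apply/idP/idP => h; [apply: trE h xy|apply: trE h yx|apply: trE yx h|apply: trE xy h].
Qed.

(* The extra vertex is equivalent to a unique chosen looped vertex, or has no
   loop, or is looped and can itself be chosen. *)
Lemma count_trans_option (c : bool) (U : finType) (k : U -> option bool) :
  count_trans c (ext k None) = #|[pred x | k x == Some true]| * count_trans c k
    + c * count_trans c (ext k (Some false)) + count_trans c (ext k (Some true)).
Proof.
pose eqv (a : U) (E : {set option U * option U}) := ((None, Some a) \in E) && ((Some a, None) \in E).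
pose cl := [set E | [exists a, (k a == Some true) && eqv a E]].
pose lp := [set E : {set option U * option U} | (None, None) \in E].
rewrite /count_trans -[LHS](cardsID cl) -[in X in _ + X](cardsID lp) addnA addnAC.
(* The looped case: being equivalent to no chosen vertex, the extra one can be chosen. *)
congr (_ + _); last first.
  apply: eq_card => E; rewrite !inE; apply/idP/marked_transP.
    case/andP=> /andP[ncl /marked_transP[trE loopE freeE neqE]] NN; split=> //.
    - by move=> [x|] b //=; [apply: (loopE (Some x))|case=> <-].
    - by move=> [x|] //=; apply: (freeE (Some x)).
    - have nocl a : k a = Some true -> ((None, Some a) \in E) -> ((Some a, None) \in E) -> False.
        by move=> ka h h'; case/existsP: ncl; exists a; rewrite ka /eqv h h'.
      move=> [x|] [y|] //= kx ky h h'; first exact: neqE.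
        by case: (nocl x).
      by case: (nocl y).
  case=> trE loopE freeE neqE; have loopN := loopE None true erefl.
  rewrite loopN andbT; apply/andP; split.
    apply/existsP => -[a /andP[/eqP ka /andP[h h']]].
    by have := neqE None (Some a) erefl ka h h'.
  apply/marked_transP; split=> //.
  - by move=> [x|] b //=; apply: (loopE (Some x)).
  - by move=> [x|] //= h; [apply: (freeE (Some x))|rewrite loopN orbT].
  - by move=> [x|] [y|] //= kx ky; apply: neqE.
congr (_ + _).
  rewrite -sum_nat_const.
  have -> : #|[set E | marked_trans c (ext k None) E] :&: cl|
      = \sum_(a | k a == Some true) #|[set E | marked_trans c (ext k None) E && eqv a E]|.
    rewrite -card_exists_uniq; first by apply: eq_card => E; rewrite !inE.
    move=> E a b /marked_transP[trE _ _ neqE] /eqP ka /eqP kb /andP[na an] /andP[nb bn].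
    by case: (neqE (Some a) (Some b) ka kb (trE _ _ _ an nb) (trE _ _ _ bn na)).
  apply: eq_bigr => a /eqP ka; apply: (card_cloned (a := a)) => E.
  - move=> /marked_transP[/transitivebP trE loopE freeE neqE]; apply/andP; split.
      apply/marked_transP; split.
      + exact/transitivebP/pull_trans.
      + by move=> [x|] b //=; rewrite in_pull; apply: loopE.
      + move=> [x|] /= kx; rewrite in_pull /=; first exact: freeE.
        by rewrite (loopE _ _ ka) orbT.
      + by move=> [x|] [y|] //= kx ky; rewrite !in_pull => h h'; congr Some; apply: neqE.
    by rewrite /eqv !in_pull /= (loopE _ _ ka).
  - case/andP => /marked_transP[/transitivebP trE loopE freeE neqE] _.
    apply/marked_transP; split.
    + exact/transitivebP/pull_trans.
    + by move=> x b kx; rewrite in_pull; apply: loopE.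
    + by move=> x kx; rewrite in_pull; apply: (freeE (Some x)).
    + move=> x y kx ky; rewrite !in_pull => h h'.
      by have [] : Some x = Some y by apply: neqE.
  - by case/andP => /marked_transP[trE _ _ _] /andP[h h']; apply: equiv_clone.
(* When [c] is false the extra vertex must have a loop, so the loopless class is empty. *)
case: c => /=; last first.
  rewrite mul0n; apply: eq_card0 => E; rewrite !inE; apply/negP => /and3P[nN _].
  by move=> /marked_transP[_ _ /(_ None erefl)]; rewrite (negbTE nN).
rewrite mul1n; apply: eq_card => E; rewrite !inE; apply/idP/marked_transP.
  case/and3P=> nN _ /marked_transP[trE loopE freeE neqE]; split=> //.
  - by move=> [x|] b //=; [apply: (loopE (Some x))|case=> <-; apply: negbTE].
  - by move=> [x|] [y|] //= kx ky; apply: neqE.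
case=> trE loopE freeE neqE; have loopN := loopE None false erefl.
rewrite loopN /=; apply/andP; split.
  by apply/existsP => -[a /andP[/eqP ka /andP[h h']]]; have := trE _ _ _ h h'; rewrite /edge loopN.
apply/marked_transP; split=> //.
- by move=> [x|] b //=; apply: (loopE (Some x)).
- by move=> [x|] [y|] //= kx ky; apply: neqE.
Qed.

(** With every vertex marked, the loops are prescribed by [k] and the relation is antisymmetric, so
    deleting the diagonal is a bijection onto the strict orders. *)
Lemma count_trans_marked (c : bool) (U : finType) (k : U -> option bool) :
  (forall x, k x != None) -> count_trans c k = count_strict (fun _ : U => false).
Proof.
move=> kN; pose diag := [set xy : U * U | xy.1 == xy.2].
have kE x : k x = Some true \/ k x = Some false by case: (k x) (kN x) => [[]|]; [left|right|].
(* Mutually related points both carry loops by transitivity, so both are chosen. *)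
have anti E x y : marked_trans c k E -> (x, y) \in E -> (y, x) \in E -> x = y.
  case/marked_transP => trE loopE _ neqE xy yx.
  have xx : (x, x) \in E by apply: trE xy yx.
  have yy : (y, y) \in E by apply: trE yx xy.
  case: (kE x) => [kx | /loopE]; last by rewrite xx.
  by case: (kE y) => [ky | /loopE]; [apply: neqE | rewrite yy].
rewrite /count_trans -(card_in_imset (f := fun E => E :\: diag)); last first.
  move=> E E'; rewrite !inE => /marked_transP[_ loopE _ _] /marked_transP[_ loopE' _ _] /setP eqE.
  apply/setP => -[x y]; have := eqE (x, y); rewrite !inE /=.
  by case: (eqVneq x y) => // <- _; case: (kE x) => kx; rewrite (loopE _ _ kx) (loopE' _ _ kx).
apply: eq_card => E; rewrite [RHS]inE; apply/imsetP/strict_ncP => [[E' + ->] | [trE irrE _]].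
  rewrite inE => mE; have /marked_transP[trE _ _ _] := mE; split=> //.
  - move=> y x z; rewrite /edge !inE /= => /andP[xy Exy] /andP[yz Eyz].
    have -> : (x, z) \in E' by apply: trE Exy Eyz.
    rewrite andbT; apply/eqP => xz; case/eqP: xy.
    by apply: anti mE Exy _; rewrite xz.
  - by move=> x; rewrite !inE eqxx.
have asym x y : (x, y) \in E -> (y, x) \in E -> False.
  by move=> xy yx; case/negP: (irrE x); apply: trE xy yx.
(* The inverse puts back the loops prescribed by [k]. *)
exists (E :|: [set xy | (xy.1 == xy.2) && (k xy.1 == Some true)]); last first.
  apply/setP => -[x y]; rewrite !inE /=.
  by case: (eqVneq x y) => [-> | _]; rewrite ?(negbTE (irrE _)) ?orbF.
rewrite inE; apply/marked_transP; split.
- move=> y x z; rewrite /edge !inE /=.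
  case/orP=> [xy | /andP[/eqP-> kx]]; last by [].
  by case/orP=> [yz | /andP[/eqP<- _]]; [have -> : (x, z) \in E by apply: trE xy yz | rewrite xy].
- by move=> x b kx; rewrite !inE (negbTE (irrE x)) eqxx kx; case: (b).
- by move=> x kx; have := kN x; rewrite kx.
- move=> x y _ _; rewrite !inE /= => /orP[xy | /andP[/eqP //]].
  by case/orP=> [/(asym _ _ xy) | /andP[/eqP]].
Qed.

Definition mark (A B C : Type) (x : A + (B + C)) : option bool :=
  match x with inl _ => None | inr (inl _) => Some false | inr (inr _) => Some true end.

(** This is V(n, a, b), with [c] true for transitive relations and false for quasi-orders. *)
Definition Trans (c : bool) (n a b : nat) : nat := count_trans c (@mark 'I_n 'I_a 'I_b).

Definition mark_count (n a b : nat) (o : option bool) : nat :=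
  match o with None => n | Some false => a | Some true => b end.

Lemma card_mark n a b o : #|[pred x | @mark 'I_n 'I_a 'I_b x == o]| = mark_count n a b o.
Proof.
have inrl_inj : injective (fun x : 'I_a => inr (inl x) : 'I_n + ('I_a + 'I_b)) by move=> x y [].
have inrr_inj : injective (fun x : 'I_b => inr (inr x) : 'I_n + ('I_a + 'I_b)) by move=> x y [].
have inl_inj' : injective (fun x : 'I_n => inl x : 'I_n + ('I_a + 'I_b)) by move=> x y [].
case: o => [[]|] /=.
- rewrite -[RHS](card_ord b) -(card_imset 'I_b inrr_inj).
  by apply: eq_card => -[x|[x|x]]; rewrite !inE /=; apply/esym/imsetP;
    [case|case|exists x].
- rewrite -[RHS](card_ord a) -(card_imset 'I_a inrl_inj).
  by apply: eq_card => -[x|[x|x]]; rewrite !inE /=; apply/esym/imsetP;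
    [case|exists x|case].
- rewrite -[RHS](card_ord n) -(card_imset 'I_n inl_inj').
  by apply: eq_card => -[x|[x|x]]; rewrite !inE /=; apply/esym/imsetP;
    [exists x|case|case].
Qed.

Lemma count_transE c (U : finType) (k : U -> option bool) n a b :
  (forall o, #|[pred x | k x == o]| = mark_count n a b o) -> count_trans c k = Trans c n a b.
Proof. by move=> kE; apply: count_trans_bij => o; rewrite card_mark kE. Qed.

Lemma Trans_rec c n a b :
  Trans c n.+1 a b = b * Trans c n a b + c * Trans c n a.+1 b + Trans c n a b.+1.
Proof.
pose k := @mark 'I_n 'I_a 'I_b.
rewrite -(@count_transE c _ (ext k None)); last by case=> [[]|]; rewrite card_ext card_mark.
rewrite count_trans_option card_mark; congr (_ + _ * _ + _);
  by apply: count_transE => -[[]|]; rewrite card_ext card_mark.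
Qed.

Lemma Trans_marked c a b : Trans c 0 a b = Strict (a + b) 0.
Proof.
rewrite /Trans count_trans_marked; last by case=> [[]//|[]].
apply: count_strictE; first by apply: eq_card0.
by rewrite !card_sum !card_ord addn0.
Qed.

(** * Eventual periodicity modulo [m] *)

Lemma eqmodD m a b a' b' :
  a = a' %[mod m] -> b = b' %[mod m] -> a + b = a' + b' %[mod m].
Proof. by move=> ea eb; rewrite -modnDm ea eb modnDm. Qed.

Lemma eqmodM m a b a' b' :
  a = a' %[mod m] -> b = b' %[mod m] -> a * b = a' * b' %[mod m].
Proof. by move=> ea eb; rewrite -modnMm ea eb modnMm. Qed.

(** All columns K >= 2m^2 vanish modulo [m], so column [K0] represents them and finitely many
    columns describe the state; the period is uniform in [K]. *)
Lemma Strict_periodic m : 0 < m ->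
  exists r q, 0 < q /\ forall n K, r <= n -> Strict (n + q) K = Strict n K %[mod m].
Proof.
move=> m_gt0; set K0 := 2 * m * m.
apply: (@finite_state_periodic nat Strict m (iota 0 K0.+1)).
- by [].
- move=> K; case: (ltnP K K0) => leK.
    by exists K => //; rewrite mem_iota add0n ltnS leq0n ltnW.
  exists K0 => [|n]; first by rewrite mem_iota add0n ltnSn.
  by rewrite !(eqP (dvdn_Strict _ m_gt0 _)).
- move=> n n' eqS K; rewrite !Strict_rec.
  by apply: eqmodD => //; apply: eqmodM.
Qed.

Lemma Trans_periodic c m : 0 < m ->
  exists r q, 0 < q /\ forall n, r <= n -> Trans c (n + q) 0 0 = Trans c n 0 0 %[mod m].
Proof.
move=> m_gt0; have [r0 [q0 [q0_gt0 perS]]] := Strict_periodic m_gt0.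
(* The factor [m] makes the coefficient [b] in [Trans_rec] periodic modulo [m] as well. *)
pose q := q0 * m.
have q_gt0 : 0 < q by rewrite muln_gt0 q0_gt0.
have perq n : r0 <= n -> Strict (n + q) 0 = Strict n 0 %[mod m].
  rewrite /q => rn; have mul_per j : Strict (n + q0 * j) 0 = Strict n 0 %[mod m]; last exact: mul_per.
  elim: j => [|j IHj]; first by rewrite muln0 addn0.
  by rewrite mulnS [q0 + _]addnC addnA perS // (leq_trans rn) // leq_addr.
(* Periodicity in [a] and in [b] passes from V(n, ., .) to V(n+1, ., .) by the recurrence; V(0, a,
   b) depends on a + b only. *)
have perT n : (forall a b, r0 <= a -> Trans c n (a + q) b = Trans c n a b %[mod m]) /\
              (forall a b, r0 <= b -> Trans c n a (b + q) = Trans c n a b %[mod m]).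
  elim: n => [|n [IHa IHb]].
    split=> a b r0le; rewrite !Trans_marked; last by rewrite addnA perq // (leq_trans r0le) ?leq_addl.
    by rewrite addnAC perq // (leq_trans r0le) ?leq_addr.
  split=> a b r0le; rewrite !Trans_rec; apply: eqmodD; try apply: eqmodD; try apply: eqmodM => //.
  - exact: IHa.
  - by rewrite -addSn IHa // ltnW.
  - exact: IHa.
  - by rewrite /q addnC modnMDl.
  - exact: IHb.
  - exact: IHb.
  - by rewrite -addSn IHb // ltnW.
(* Subtracting [q] repeatedly brings [a] below [r0 + q], for all [n] and [b] at once. *)
have fold a : exists2 a', a' < r0 + q & forall n b, Trans c n a b = Trans c n a' b %[mod m].
  have [j] := ubnP a; elim: j a => // j IHj a ltaj.
  case: (ltnP a (r0 + q)) => la; first by exists a.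
  have [|a' la' aE] := IHj (a - q); first by lia.
  exists a' => // n b; rewrite -aE -(proj1 (perT n) (a - q)) ?subnK //; lia.
have foldb b : exists2 b', b' < r0 + q & forall n a, Trans c n a b = Trans c n a b' %[mod m].
  have [j] := ubnP b; elim: j b => // j IHj b ltbj.
  case: (ltnP b (r0 + q)) => lb; first by exists b.
  have [|b' lb' bE] := IHj (b - q); first by lia.
  exists b' => // n a; rewrite -bE -(proj2 (perT n) _ (b - q)) ?subnK //; lia.
have [|||r [q' [q'_gt0 perV]]] := @finite_state_periodic (nat * nat)%type
    (fun n ab => Trans c n ab.1 ab.2) m (allpairs pair (iota 0 (r0 + q)) (iota 0 (r0 + q))).
- by [].
- move=> [a b]; have [a' la' aE] := fold a; have [b' lb' bE] := foldb b.
  exists (a', b'); last by move=> n /=; rewrite aE bE.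
  by apply/allpairsP; exists (a', b'); rewrite !mem_iota.
- move=> n n' eqT [a b] /=; rewrite !Trans_rec.
  have e a1 b1 : Trans c n a1 b1 = Trans c n' a1 b1 %[mod m] by have := eqT (a1, b1).
  by apply: eqmodD => //; apply: eqmodD; apply: eqmodM.
by exists r, q'; split=> // n rn; have := perV n (0, 0) rn.
Qed.

(** * The three sequences as values of S and V *)

Lemma PO_Strict n : PO n = Strict n 0.
Proof.
(* A partial order is a transitive relation whose vertices are all looped and pairwise inequivalent;
   deleting its diagonal leaves a strict order. *)
transitivity (count_trans false (fun _ : 'I_n => Some true)).
  apply: eq_card => E; rewrite !inE; apply/and3P/marked_transP.
    case=> /reflexivebP rE /antisymmetricbP aE /transitivebP tE; split=> // [x b [<-]|x y _ _ xy yx].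
      exact: rE.
    by apply: aE; rewrite /rel_of xy yx.
  case=> tE lE _ nE; split; last exact/transitivebP.
    by apply/reflexivebP => x; apply: lE.
  by apply/antisymmetricbP => x y /andP[]; apply: nE.
by rewrite count_trans_marked //; apply: count_strictE; rewrite ?card_ord ?addn0 //; apply: eq_card0.
Qed.

Lemma free_count c n : count_trans c (fun _ : 'I_n => None) = Trans c n 0 0.
Proof.
by apply: count_transE => -[[]|] /=; [apply: eq_card0|apply: eq_card0|rewrite -[RHS]card_ord; apply: eq_card].
Qed.

Lemma QO_Trans n : QO n = Trans false n 0 0.
Proof.
rewrite -free_count; apply: eq_card => E; rewrite !inE; apply/andP/marked_transP.
  by case=> /reflexivebP rE /transitivebP tE; split=> // x _; apply: rE.
case=> tE _ lE _; split; last exact/transitivebP.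
by apply/reflexivebP => x; apply: lE.
Qed.

Lemma Tr_Trans n : Tr n = Trans true n 0 0.
Proof.
rewrite -free_count; apply: eq_card => E; rewrite !inE; apply/transitivebP/marked_transP => [tE|[]//].
by split.
Qed.

Theorem corollary3p2 :
  [/\ MC_finite (fun n => Posz (PO n)),
      MC_finite (fun n => Posz (QO n)) &
      MC_finite (fun n => Posz (Tr n))].
Proof.
split; apply: periodic_MC_finite => m m_gt0.
- have [r [q [q_gt0 per]]] := Strict_periodic m_gt0.
  by exists r, q; split=> // n rn; rewrite !PO_Strict per.
- have [r [q [q_gt0 per]]] := Trans_periodic false m_gt0.
  by exists r, q; split=> // n rn; rewrite !QO_Trans per.
- have [r [q [q_gt0 per]]] := Trans_periodic true m_gt0.
  by exists r, q; split=> // n rn; rewrite !Tr_Trans per.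
Qed.
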